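(* Let $K$ be any field, and let $$\mathrm{perm}_3=\sum_{\sigma\in\Sigma_3}e_{\sigma(1)}\otimes e_{\sigma(2)}\otimes e_{\sigma(3)}\in K^3\otimes K^3\otimes K^3,$$ where $e_1,e_2,e_3$ is the standard basis of $K^3$ and $\Sigma_3$ is the symmetric group on $3$ letters. Then $\operatorname{brk}(\mathrm{perm}_3)\ge 4$.
   Context: The tensor rank of $T\in K^a\otimes K^b\otimes K^c$ is the smallest $n$ such that $T$ is a sum of $n$ pure tensors $u\otimes v\otimes w$. Let $Z_n$ be the set of tensors of tensor rank $\le n$ and $\overline Z_n$ its Zariski closure (in the affine space $K^a\otimes K^b\otimes K^c$ over $K$). The border rank $\operatorname{brk}(T)$ is the smallest $n$ such that $T\in\overline Z_n$. *)

(* Defs.v *)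
From mathcomp Require Import all_boot all_order all_algebra all_fingroup.
From mathcomp Require Import boolp.
From mathcomp Require Import mpoly.
Set Implicit Arguments.
Unset Strict Implicit.
Unset Printing Implicit Defensive.
Import GRing.Theory.
Local Open Scope ring_scope.

(* K^a (x) K^b (x) K^c in coordinates: the array T stands for
   \sum_(i, j, k) T (i, j, k) *: (e_i (x) e_j (x) e_k). *)
Notation tensor K a b c := {ffun 'I_a * 'I_b * 'I_c -> K}.

Definition pure_tensor (K : fieldType) (a b c : nat)
    (u : 'rV[K]_a) (v : 'rV[K]_b) (w : 'rV[K]_c) : tensor K a b c :=
  [ffun i => u 0 i.1.1 * v 0 i.1.2 * w 0 i.2].

Definition sum_of_pure (K : fieldType) (a b c : nat) (T : tensor K a b c)
    (n : nat) : Prop :=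
  exists (u : 'I_n -> 'rV[K]_a) (v : 'I_n -> 'rV[K]_b) (w : 'I_n -> 'rV[K]_c),
    T = \sum_(l < n) pure_tensor (u l) (v l) (w l).

Lemma sum_of_pure_exists (K : fieldType) (a b c : nat) (T : tensor K a b c) :
  exists n, `[< sum_of_pure T n >].
Proof.
exists #|{: 'I_a * 'I_b * 'I_c}|; apply/asboolP.
exists (fun l => T (enum_val l) *: delta_mx 0 (enum_val l).1.1).
exists (fun l => delta_mx 0 (enum_val l).1.2).
exists (fun l => delta_mx 0 (enum_val l).2).
apply/ffunP => x; rewrite sum_ffunE (bigD1 (enum_rank x)) //= big1 => [|l ne].
  by rewrite addr0 ffunE enum_rankK !mxE !eqxx /= !mulr1.
rewrite ffunE !mxE !eqxx /=.
have : enum_val l != x by apply: contraNneq ne => <-; rewrite enum_valK.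
case: (enum_val l) => -[i j] k; case: x {ne} => -[i' j'] k' /=.
rewrite -pair_eqE /= -pair_eqE /= (eq_sym i) (eq_sym j) (eq_sym k).
by case: (i' == i); case: (j' == j); case: (k' == k);
  rewrite //= ?mulr0 ?mul0r ?mulr0.
Qed.

Definition tensor_rank (K : fieldType) (a b c : nat) (T : tensor K a b c) :
  nat := ex_minn (sum_of_pure_exists T).

Definition rank_le (K : fieldType) (a b c n : nat) (T : tensor K a b c) :
  Prop := (tensor_rank T <= n)%N.

(* The polynomial functions on the affine space of tensors: one variable per
   coordinate, numbered by the enumeration of the index triples. *)
Definition teval (K : fieldType) (a b c : nat)
    (p : {mpoly K[#|{: 'I_a * 'I_b * 'I_c}|]}) (T : tensor K a b c) : K :=
  p.@[fun l => T (enum_val l)].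

(* Equations have coefficients in K, so that over a finite field every set of
   tensors is closed. *)
Definition zariski_closure (K : fieldType) (a b c : nat)
    (Z : tensor K a b c -> Prop) (T : tensor K a b c) : Prop :=
  forall p : {mpoly K[#|{: 'I_a * 'I_b * 'I_c}|]},
    (forall S, Z S -> teval p S = 0) -> teval p T = 0.

Lemma zariski_closure_rank_le_exists (K : fieldType) (a b c : nat)
  (T : tensor K a b c) : exists n, `[< zariski_closure (rank_le n) T >].
Proof. by exists (tensor_rank T); apply/asboolP => p; apply; exact: leqnn. Qed.

Definition border_rank (K : fieldType) (a b c : nat) (T : tensor K a b c) :
  nat := ex_minn (zariski_closure_rank_le_exists T).

Definition std_basis (K : fieldType) (n : nat) (i : 'I_n) : 'rV[K]_n :=
  delta_mx 0 i.

(* The letters 1, 2, 3 are the elements 0, 1, 2 of 'I_3. *)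
Definition perm3 (K : fieldType) : tensor K 3 3 3 :=
  \sum_(s : 'S_3)
    pure_tensor (std_basis K (s 0)) (std_basis K (s 1)) (std_basis K (s 2)).

(* Main.v *)
Require Import Defs.
From mathcomp Require Import all_boot all_algebra.
From mathcomp Require Import perm boolp mpoly.

(** Strassen's commutation equations separate [perm3] from the tensors of rank
    at most 3. Read a tensor as the family of its slices [A_i], where [A_i] is
    the matrix of the entries [T (i, j, k)]. A sum of n pure tensors of format
    (a, n, n) has slices [A_i = V^T D_i W] with V and W square and the [D_i]
    diagonal. As the adjugate reverses products,
      [A_i adj(A_j) A_k = det(V) det(W) V^T D_i adj(D_j) D_k W],
    and this is symmetric in i and k, because diagonal matrices commute
    ([sum_of_pure_adj_commutator]). Inverses in place of adjugates would not
    do: in characteristic 2 every linear combination of the slices of [perm3]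
    is singular. With the adjugate the identity is polynomial and needs no
    invertible slice.

    So every entry of [A_0 adj(A_2) A_1 - A_1 adj(A_2) A_0] is a polynomial in
    the entries of the tensor that vanishes on the tensors of rank at most 3,
    hence on their closure. For [perm3] the slice [A_i] is [E_jk + E_kj] with
    {i, j, k} = {0, 1, 2}. The first product then has a zero row of index 0, and
    the second is [E_02 adj(A_2) E_21 = - E_01] on that row, so the entry
    (0, 1) of the difference is 1, which is nonzero in every characteristic.

    The two facts on adjugates ([adj_mulmx], [comm_mx_adj]) are immediate when
    determinants may be cancelled. They hold over any commutative ring, because
    replacing [A] by [A + X] over the polynomials makes its determinant monic,
    and evaluation at 0 gives back [A]. *)

Set Implicit Arguments.
Unset Strict Implicit.
Unset Printing Implicit Defensive.
Import GRing.Theory.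
Local Open Scope ring_scope.

Section Adjugate.
Variables (R : comNzRingType) (n : nat).
Implicit Types A B : 'M[R]_n.

Lemma mulmx_lreg_det (M A : 'M[R]_n) :
  GRing.lreg (\det A) -> M *m A = 0 -> M = 0.
Proof.
move=> regA MA0.
have : \det A *: M = 0 by rewrite -mul_mx_scalar -mul_mx_adj mulmxA MA0 mul0mx.
move=> /matrixP dM0; apply/matrixP=> i j; move: (dM0 i j); rewrite !mxE.
by move=> dMij; apply: regA; rewrite dMij mulr0.
Qed.

(** The matrix [A + X]: a perturbation of [A] whose determinant can be
    cancelled, being monic. *)
Definition shift_mx A : 'M[{poly R}]_n := char_poly_mx (- A).

Lemma det_shift_mx_monic A : \det (shift_mx A) \is monic.
Proof. exact: char_poly_monic. Qed.

Lemma shift_mx_eval0 A : map_mx (horner_eval 0) (shift_mx A) = A.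
Proof.
apply/matrixP=> i j; rewrite !mxE /horner_eval.
by rewrite hornerD hornerMn hornerX mul0rn add0r !hornerE opprK.
Qed.

End Adjugate.

(** Multiplied on the right by [A *m B], both sides become the scalar matrix
    [\det A * \det B]; the shifted matrices allow cancelling that factor. *)
Lemma adj_mulmx (R : comNzRingType) (n : nat) (A B : 'M[R]_n) :
  \adj (A *m B) = \adj B *m \adj A.
Proof.
rewrite -[A in LHS]shift_mx_eval0 -[B in LHS]shift_mx_eval0.
rewrite -[A in RHS]shift_mx_eval0 -[B in RHS]shift_mx_eval0.
rewrite -map_mxM -!map_mx_adj -map_mxM; congr map_mx.
set C := shift_mx A; set D := shift_mx B.
apply/subr0_eq; apply: (@mulmx_lreg_det _ _ _ (C *m D)).
  by apply: monic_lreg; rewrite det_mulmx monicMl det_shift_mx_monic.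
rewrite mulmxBl mul_adj_mx -mulmxA [_ *m (C *m D)]mulmxA mul_adj_mx.
by rewrite mul_scalar_mx -scalemxAr mul_adj_mx det_mulmx scale_scalar_mx subrr.
Qed.

(** [A *m \adj B] and [\adj B *m A] both become [\det B *: A] when multiplied on
    the right by B. Only B is shifted: A still commutes with [B + X]. *)
Lemma comm_mx_adj (R : comNzRingType) (n : nat) (A B : 'M[R]_n) :
  comm_mx A B -> comm_mx A (\adj B).
Proof.
rewrite /comm_mx => AB; pose C := map_mx polyC A; pose D := shift_mx B.
have CD : C *m D = D *m C.
  rewrite /D /shift_mx /char_poly_mx mulmxBr mulmxBl scalar_mxC; congr (_ - _).
  by rewrite -!map_mxM mulmxN mulNmx AB.
have evalC : map_mx (horner_eval 0) C = A.
  by apply/matrixP=> i j; rewrite !mxE /horner_eval hornerC.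
have : C *m \adj D = \adj D *m C.
  apply/subr0_eq; apply: (@mulmx_lreg_det _ _ _ D).
    exact/monic_lreg/det_shift_mx_monic.
  by rewrite mulmxBl -!mulmxA mul_adj_mx CD [\adj D *m _]mulmxA mul_adj_mx
             scalar_mxC subrr.
move=> /(congr1 (map_mx (horner_eval 0))).
by rewrite !map_mxM map_mx_adj evalC shift_mx_eval0.
Qed.

Definition adj_commutator (R : comNzRingType) (n : nat) (A B C : 'M[R]_n) :
  'M[R]_n := A *m \adj B *m C - C *m \adj B *m A.

Lemma map_adj_commutator (R S : comNzRingType) (f : {rmorphism R -> S})
    (n : nat) (A B C : 'M[R]_n) :
  map_mx f (adj_commutator A B C)
  = adj_commutator (map_mx f A) (map_mx f B) (map_mx f C).
Proof. by rewrite /adj_commutator map_mxB !map_mxM !map_mx_adj. Qed.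

(** The outer factors pull out of both products as [\det P * \det Q], and
    between P and Q only diagonal matrices and the adjugate of one of them
    remain, which all commute. *)
Lemma adj_commutator_diag (R : comNzRingType) (n : nat) (P Q : 'M[R]_n)
    (a b c : 'rV[R]_n) :
  adj_commutator (P *m diag_mx a *m Q) (P *m diag_mx b *m Q)
                 (P *m diag_mx c *m Q) = 0.
Proof.
have sandwich (x y : 'rV[R]_n) :
    (P *m diag_mx x *m Q) *m \adj (P *m diag_mx b *m Q) *m (P *m diag_mx y *m Q)
    = (\det P * \det Q) *: (P *m (diag_mx x *m \adj (diag_mx b) *m diag_mx y)
                              *m Q).
  rewrite !adj_mulmx.
  have -> : P *m diag_mx x *m Q *m (\adj Q *m (\adj (diag_mx b) *m \adj P)) *m
     (P *m diag_mx y *m Q) = P *m diag_mx x *m (Q *m \adj Q) *m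
       \adj (diag_mx b) *m (\adj P *m P) *m diag_mx y *m Q by rewrite !mulmxA.
  rewrite mul_mx_adj mul_adj_mx !mul_mx_scalar -!scalemxAl scalerA.
  by rewrite !mulmxA.
rewrite /adj_commutator !sandwich; apply/eqP; rewrite subr_eq0; apply/eqP.
congr (_ *: (_ *m _ *m _)).
rewrite (comm_mx_adj (diag_mx_comm a b)) (comm_mx_adj (diag_mx_comm c b)).
by rewrite -!mulmxA diag_mxC.
Qed.

Definition slice (K : fieldType) (a b c : nat) (T : tensor K a b c) (i : 'I_a) :
  'M[K]_(b, c) := \matrix_(j, k) T (i, j, k).

Lemma sum_of_pure_adj_commutator (K : fieldType) (a n : nat)
    (T : tensor K a n n) (i j k : 'I_a) :
  sum_of_pure T n -> adj_commutator (slice T i) (slice T j) (slice T k) = 0.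
Proof.
case=> u [v [w ->]].
pose P : 'M[K]_n := \matrix_(r, l) v l 0 r.
pose Q : 'M[K]_n := \matrix_(l, s) w l 0 s.
have sliceE t : slice (\sum_(l < n) pure_tensor (u l) (v l) (w l)) t
               = P *m diag_mx (\row_l u l 0 t) *m Q.
  apply/matrixP=> r s; rewrite mul_mx_diag !mxE sum_ffunE.
  by apply: eq_bigr => l _; rewrite !mxE ffunE /= [v l 0 r * _]mulrC.
by rewrite !sliceE adj_commutator_diag.
Qed.

Lemma sum_of_pure_leq (K : fieldType) (a b c m n : nat) (T : tensor K a b c) :
  (m <= n)%N -> sum_of_pure T m -> sum_of_pure T n.
Proof.
move=> /subnKC <-; elim: (n - m)%N => [|d IHd]; first by rewrite addn0.
move=> /IHd [u [v [w ->]]]; rewrite addnS.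
exists (fun l => oapp u 0 (unlift ord0 l)), (fun l => oapp v 0 (unlift ord0 l)).
exists (fun l => oapp w 0 (unlift ord0 l)).
rewrite big_ord_recl unlift_none /=.
have -> : pure_tensor 0 0 0 = 0 :> tensor K a b c.
  by apply/ffunP=> x; rewrite !ffunE !mxE !mul0r.
by rewrite add0r; apply: eq_bigr => l _; rewrite liftK.
Qed.

Lemma rank_le_sum_of_pure (K : fieldType) (a b c n : nat) (T : tensor K a b c) :
  rank_le n T -> sum_of_pure T n.
Proof.
rewrite /rank_le /tensor_rank; case: ex_minnP => m /asboolP Tm _ le_mn.
exact: sum_of_pure_leq Tm.
Qed.

(** An entry of Strassen's commutator is a polynomial in the tensor: it is the
    same entry computed from the slices of the generic tensor, whose
    coordinates are the indeterminates. *)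
Lemma closure_adj_commutator (K : fieldType) (a n : nat)
    (T : tensor K a n n) (i j k : 'I_a) :
  zariski_closure (rank_le n) T ->
  adj_commutator (slice T i) (slice T j) (slice T k) = 0.
Proof.
move=> clT; apply/matrixP=> r s; rewrite [RHS]mxE.
pose X t : 'M[{mpoly K[#|{: 'I_a * 'I_n * 'I_n}|]}]_n :=
  \matrix_(y, z) 'X_(enum_rank (t, y, z)).
have evalE (S : tensor K a n n) : teval (adj_commutator (X i) (X j) (X k) r s) S
    = adj_commutator (slice S i) (slice S j) (slice S k) r s.
  have evalX t : map_mx (meval (fun l => S (enum_val l))) (X t) = slice S t.
    by apply/matrixP=> y z; rewrite !mxE mevalXU enum_rankK.
  by rewrite -!evalX -map_adj_commutator [RHS]mxE.
rewrite -evalE; apply: clT => S /rank_le_sum_of_pure rkS.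
by rewrite evalE sum_of_pure_adj_commutator // mxE.
Qed.

Lemma perm3E (K : fieldType) (i j k : 'I_3) :
  perm3 K (i, j, k) = (uniq [:: i; j; k])%:R.
Proof.
rewrite /perm3 sum_ffunE.
have termE (s : 'S_3) : pure_tensor (std_basis K (s 0)) (std_basis K (s 1))
    (std_basis K (s 2)) (i, j, k) = [&& i == s 0, j == s 1 & k == s 2]%:R.
  rewrite ffunE !mxE !eqxx /=.
  by do 3 case: (_ == _); rewrite ?mulr1 ?mulr0 ?mul0r.
under eq_bigr do rewrite termE.
have [ijk_uniq|not_uniq] := boolP (uniq [:: i; j; k]); last first.
  rewrite big1 // => s _; case: and3P => // -[/eqP i_s /eqP j_s /eqP k_s].
  by move: not_uniq; rewrite i_s j_s k_s -[[:: _; _; _]]/(map s [:: 0; 1; 2])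
    map_inj_uniq //; apply: perm_inj.
(* A triple of distinct letters is the list of values of exactly one
   permutation. *)
have s_inj : injective (fun t : 'I_3 => nth i [:: i; j; k] t).
  by move=> x y /eqP; rewrite nth_uniq // => /eqP/val_inj.
pose s0 := perm s_inj.
have s_eq_s0 (s : 'S_3) : [&& i == s 0, j == s 1 & k == s 2] = (s == s0).
  apply/and3P/eqP => [[/eqP i_s /eqP j_s /eqP k_s] | ->]; last by rewrite !permE.
  apply/perm.permP=> t; rewrite permE.
  case: t => [[|[|[|//]]] lt_t] /=; rewrite ?i_s ?j_s ?k_s; congr (s _);
    exact: val_inj.
rewrite (bigD1 s0) //= s_eq_s0 eqxx big1 ?addr0 // => s.
by rewrite s_eq_s0 => /negPf->.
Qed.

Lemma perm3_adj_commutator (K : fieldType) :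
  adj_commutator (slice (perm3 K) 0) (slice (perm3 K) 2) (slice (perm3 K) 1) 0 1
  = 1.
Proof.
have adj22 : (\adj (slice (perm3 K) 2)) 2 2 = -1.
  rewrite mxE /cofactor (expand_det_row _ 0) !big_ord_recl big_ord0.
  rewrite /cofactor !det_mx11 !mxE !perm3E /= -[X in _ ^+ X * _]/4%N.
  by rewrite -[(0 + bump 0 0)%N]/1%N !(mul0r, mul1r, add0r, addr0, mulr1)
             -signr_odd mul1r expr1.
rewrite /adj_commutator !mxE !big_ord_recl !big_ord0 !mxE !big_ord_recl !big_ord0.
rewrite ![slice _ _ _ _]mxE !perm3E /=.
(* Among the nine entries of the adjugate, only the last one is ever
   multiplied by nonzero entries of the other two slices. *)
have -> : lift ord0 (lift ord0 ord0) = 2 :> 'I_3 by exact: val_inj.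
by rewrite adj22 !(mul0r, mul1r, add0r, addr0, mulr0, mulr1, sub0r, opprK).
Qed.

Theorem lemma1p13 (K : fieldType) : (4 <= border_rank (perm3 K))%N.
Proof.
rewrite /border_rank; case: ex_minnP => n /asboolP cln _.
rewrite ltnNge; apply/negP => le_n3.
have cl3 : zariski_closure (rank_le 3) (perm3 K).
  by move=> p p0; apply: cln => S rkS; apply: p0; apply: leq_trans rkS le_n3.
have := perm3_adj_commutator K.
by rewrite closure_adj_commutator // mxE => /esym/eqP; rewrite oner_eq0.
Qed.
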